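(* Consider the system $\Sigma$ with transfer matrix $G(s)=C(sI_n-A)^{-1}B+D\in\mathbb{R}(s)^{p\times m}$, and assume $G(s)$ is left-invertible as a rational function matrix. Let $$2n_s:=\deg\Big(\det(sI_n-A)\,\det(-sI_n-A)\,\det\big(G(-s)^TG(s)\big)\Big),$$ i.e. twice $n_s$ is the degree of the numerator of $\det(G(-s)^TG(s))$ before pole-zero cancellation. Then the strongly reachable subspace $\mathcal{R}_s$ of $\Sigma$ has dimension $n_f:=n-n_s$.
   Context: $\Sigma$ is the system $\dot x=Ax+Bu$, $y=Cx+Du$ with $A\in\mathbb{R}^{n\times n}$, $B\in\mathbb{R}^{n\times m}$, $C\in\mathbb{R}^{p\times n}$, $D\in\mathbb{R}^{p\times m}$. Left-invertibility of $G$ implies $G(-s)^TG(s)$ is square and nonsingular, and the displayed product is an even polynomial. Impulsive-smooth inputs are distributions $u=u_{\rm reg}+\sum_{i=0}^k a_i\delta^{(i)}$ with $u_{\rm reg}$ the restriction to $\mathbb{R}_+$ of a $C^\infty$ function and $a_i\in\mathbb{R}^m$ ($\delta^{(i)}$ the derivatives of the Dirac distribution). A state $x_1\in\mathbb{R}^n$ is strongly reachable if there is an impulsive-smooth input $u$ such that the state trajectory from $x(0^-)=0$ satisfies $x(0^+)=x_1$ and the output is impulse-free (restriction to $\mathbb{R}_+$ of a $C^\infty$ function); the set of such states is the strongly reachable subspace $\mathcal{R}_s$. Equivalently (Hautus–Silverman), $\mathcal{R}_s$ is the stationary value of $\mathcal{R}_0=\{0\}$, $\mathcal{R}_{i+1}=\{Aw+B\alpha: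 w\in\mathcal{R}_i,\ \alpha\in\mathbb{R}^m,\ Cw+D\alpha=0\}$. *)

(* Defs.v *)
From HB Require Import structures.
From mathcomp Require Import all_boot all_order all_algebra.
Set Implicit Arguments. Unset Strict Implicit. Unset Printing Implicit Defensive.
Import Order.TTheory GRing.Theory Num.Theory.
Local Open Scope ring_scope.

Definition ratf (R : realFieldType) := {fraction {poly R}}.

Definition pfrac (R : realFieldType) (q : {poly R}) : ratf R :=
  FracField.tofrac q.

Definition svar (R : realFieldType) : ratf R := pfrac 'X.

Definition cmx (R : realFieldType) (k l : nat) (M : 'M[R]_(k, l))
  : 'M[ratf R]_(k, l) := map_mx (fun a => pfrac a%:P) M.

Definition transfer (R : realFieldType) (n m p : nat)
  (A : 'M[R]_n) (B : 'M[R]_(n, m)) (C : 'M[R]_(p, n)) (D : 'M[R]_(p, m))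
  (z : ratf R) : 'M[ratf R]_(p, m) :=
  cmx C *m invmx (z *: 1%:M - cmx A) *m cmx B + cmx D.

Definition tfG (R : realFieldType) (n m p : nat)
  (A : 'M[R]_n) (B : 'M[R]_(n, m)) (C : 'M[R]_(p, n)) (D : 'M[R]_(p, m)) :=
  transfer A B C D (svar R).

Definition tfGneg (R : realFieldType) (n m p : nat)
  (A : 'M[R]_n) (B : 'M[R]_(n, m)) (C : 'M[R]_(p, n)) (D : 'M[R]_(p, m)) :=
  transfer A B C D (- svar R).

Definition left_invertible (F : fieldType) (p m : nat) (G : 'M[F]_(p, m)) :=
  exists L : 'M[F]_(m, p), L *m G = 1%:M.

Definition spectral_product (R : realFieldType) (n m p : nat)
  (A : 'M[R]_n) (B : 'M[R]_(n, m)) (C : 'M[R]_(p, n)) (D : 'M[R]_(p, m))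
  : ratf R :=
  \det (svar R *: 1%:M - cmx A) * \det ((- svar R) *: 1%:M - cmx A) *
  \det ((tfGneg A B C D)^T *m tfG A B C D).

(* Hautus--Silverman recursion, with subspaces of R^n represented (as usual
   in mxalgebra) by row spaces of matrices, vectors being row vectors:
   R_{i+1} = { A w + B a : w in R_i, a in R^m, C w + D a = 0 },
   i.e. in row form { w A^T + a B^T : w in R_i, w C^T + a D^T = 0 }. *)
Definition hs_step (R : realFieldType) (n m p : nat)
  (A : 'M[R]_n) (B : 'M[R]_(n, m)) (C : 'M[R]_(p, n)) (D : 'M[R]_(p, m))
  (S : 'M[R]_n) : 'M[R]_n :=
  (<< (((row_mx S (0 : 'M[R]_(n, m))) + (row_mx (0 : 'M[R]_(m, n)) 1%:M))
        :&: kermx (col_mx C^T D^T))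
      *m col_mx A^T B^T >>)%MS.

Definition hs_iter (R : realFieldType) (n m p : nat)
  (A : 'M[R]_n) (B : 'M[R]_(n, m)) (C : 'M[R]_(p, n)) (D : 'M[R]_(p, m))
  (i : nat) : 'M[R]_n :=
  iter i (hs_step A B C D) 0.

(* Strongly reachable subspace: the stationary value of the (nondecreasing)
   chain R_0 <= R_1 <= ..., reached after at most n steps. *)
Definition strongly_reachable (R : realFieldType) (n m p : nat)
  (A : 'M[R]_n) (B : 'M[R]_(n, m)) (C : 'M[R]_(p, n)) (D : 'M[R]_(p, m))
  : 'M[R]_n := hs_iter A B C D n.

(* Main.v *)
Require Import Defs.
From HB Require Import structures.
From mathcomp Require Import all_boot all_order all_algebra.
From mathcomp Require Import perm ring zify.
Import Order.TTheory GRing.Theory Num.Theory.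
Local Open Scope ring_scope.

(** Everything is transposed, so that subspaces are row spaces: with [a = A^T],
    [b = B^T], [c = C^T], [d = D^T] one has [G(s)^T = b (s - a)^-1 c + d].  Let [T]
    be a basis of [R_s], of dimension [r].  Since [R_s] is the stationary value of
    the recursion, some output injection [K] makes it invariant:
    [T a + T c K = A1 T] and [b + d K = B1 T].  Counting dimensions, [[T c; d]]
    has rank at most [m], so it equals [[C1; D1] Q] with [Q] having [m] rows.  This
    yields [G^T = g1 Q V] where [g1 = B1 (s - A1)^-1 C1 + D1] is square and
    [V = 1 - K (s - a)^-1 c] tends to [1] at infinity.

    Every state of [R_s] is reached by a polynomial input with zero output; hence
    the pencil [P(s) = [s - A1, C1; - B1, D1]] satisfies [det P(s) | det P(s + 1)],
    so [det P] is a nonzero constant and [det g1] has degree [- r].  As [Q Q^T] is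
    positive definite, [det (Q V(-s) V(s)^T Q^T)] has degree [0], and the spectral
    product has degree [2 n - 2 r]. *)

(** * The Hautus-Silverman recursion and its stationarity *)

(** The rows of [Y] are [k] states treated at once; with a whole basis for [Y], an inclusion of
    subspaces becomes a pair of matrix equations. *)
Lemma hs_stepP (R : realFieldType) (n m p k : nat)
  (A : 'M[R]_n) (B : 'M[R]_(n, m)) (C : 'M[R]_(p, n)) (D : 'M[R]_(p, m))
  (S : 'M[R]_n) (Y : 'M[R]_(k, n)) :
  (Y <= hs_step A B C D S)%MS <->
  exists (w : 'M[R]_(k, n)) (u : 'M[R]_(k, m)),
    [/\ (w <= S)%MS, w *m C^T + u *m D^T = 0 & Y = w *m A^T + u *m B^T].
Proof.
rewrite /hs_step genmxE; split.
  case/submxP=> Z ->; rewrite mulmxA.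
  set E := Z *m _.
  have : (E <= (row_mx S (0 : 'M[R]_(n, m)) + row_mx (0 : 'M[R]_(m, n)) 1%:M)
              :&: kermx (col_mx C^T D^T))%MS by exact: submxMl.
  rewrite sub_capmx => /andP[/sub_addsmxP[[u1 u2] /= EE] /sub_kermxP].
  rewrite EE !mul_mx_row !mulmx0 mulmx1 add_row_mx addr0 add0r !mul_row_col => K0.
  by exists (u1 *m S), u2; split=> //; apply: submxMl.
case=> w [u [/submxP[v ->] K0 ->]]; rewrite -mul_row_col; apply: submxMr.
rewrite sub_capmx; apply/andP; split; last by apply/sub_kermxP; rewrite mul_row_col.
apply/sub_addsmxP; exists (v, u) => /=.
by rewrite !mul_mx_row !mulmx0 mulmx1 add_row_mx addr0 add0r.
Qed.

Lemma hs_step_mono (R : realFieldType) (n m p : nat)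
  (A : 'M[R]_n) (B : 'M[R]_(n, m)) (C : 'M[R]_(p, n)) (D : 'M[R]_(p, m))
  (S1 S2 : 'M[R]_n) :
  (S1 <= S2)%MS -> (hs_step A B C D S1 <= hs_step A B C D S2)%MS.
Proof.
move=> S12; apply/hs_stepP.
have /hs_stepP[w [u [wS K0 E]]] := submx_refl (hs_step A B C D S1).
by exists w, u; split=> //; apply: submx_trans S12.
Qed.

Lemma hs_iter_leS (R : realFieldType) (n m p : nat)
  (A : 'M[R]_n) (B : 'M[R]_(n, m)) (C : 'M[R]_(p, n)) (D : 'M[R]_(p, m)) i :
  (hs_iter A B C D i <= hs_iter A B C D i.+1)%MS.
Proof. by elim: i => [|i IH]; [rewrite sub0mx | apply: hs_step_mono]. Qed.

(** A strict inclusion raises the rank, and a step that adds nothing is followed only by such steps;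
    growth at step [n] would therefore need a rank above [n]. *)
Lemma hs_iter_stationary (R : realFieldType) (n m p : nat)
  (A : 'M[R]_n) (B : 'M[R]_(n, m)) (C : 'M[R]_(p, n)) (D : 'M[R]_(p, m)) :
  (hs_iter A B C D n.+1 <= hs_iter A B C D n)%MS.
Proof.
have H k : (hs_iter A B C D k.+1 <= hs_iter A B C D k)%MS \/
           (k < \rank (hs_iter A B C D k.+1))%N.
  elim: k => [|k [IH|IH]]; first 1 last.
  - by left; apply: hs_step_mono.
  - case le: (hs_iter A B C D k.+2 <= hs_iter A B C D k.+1)%MS; [by left|right].
    by apply: leq_ltn_trans IH _; apply: rank_ltmx; rewrite ltmxE hs_iter_leS le.
  - case: (eqVneq (hs_iter A B C D 1) 0) => [->|nz]; [left|right].
      exact: sub0mx.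
    by rewrite lt0n mxrank_eq0.
by case: (H n) => // /leq_trans /(_ (rank_leq_row _)); rewrite ltnn.
Qed.

(** * Linear algebra: left kernels, rank factorization, Schur complements *)

(** The rows of [1 - M (pinvmx M)] lie in the left kernel of [M], so [Y] kills them. *)
Lemma mulmx_pinv_ker (F : fieldType) (k p l : nat)
  (M : 'M[F]_(k, p)) (Y : 'M[F]_(k, l)) :
  kermx M *m Y = 0 -> M *m (pinvmx M *m Y) = Y.
Proof.
move=> kY; apply/eqP; rewrite eq_sym -subr_eq0 mulmxA -{1}[Y]mul1mx -mulmxBl.
have /submxP[Z ->] : ((1%:M - M *m pinvmx M)%R <= kermx M)%MS.
  by apply/sub_kermxP; rewrite mulmxBl mul1mx mulmxKpV // subrr.
by rewrite -mulmxA kY mulmx0.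
Qed.

(* The output injection making the row space of [T] conditioned invariant. *)
Lemma output_injection (F : fieldType) (k p l r : nat)
  (M : 'M[F]_(k, p)) (N : 'M[F]_(k, l)) (T : 'M[F]_(r, l)) :
  (kermx M *m N <= T)%MS ->
  exists (K : 'M[F]_(p, l)) (Z : 'M[F]_(k, r)), N + M *m K = Z *m T.
Proof.
(* Multiplying by [cokermx T] means working modulo the row space of [T]; there [N] vanishes on the
   left kernel of [M], hence factors through [M]. *)
rewrite submxE => /eqP; rewrite -mulmxA => /mulmx_pinv_ker E.
exists (- (pinvmx M *m N)).
have /submxP[Z ->] : ((N + M *m - (pinvmx M *m N))%R <= T)%MS; last by exists Z.
by rewrite submxE mulmxDl mulmxN mulNmx -2!mulmxA E subrr.
Qed.

Lemma rank_factor (F : fieldType) (k p m : nat) (M : 'M[F]_(k, p)) :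
  (\rank M <= m)%N -> exists (M1 : 'M[F]_(k, m)) (Q : 'M[F]_(m, p)), M = M1 *m Q.
Proof.
move=> le_m; exists (col_ebase M *m pid_mx (\rank M)), (pid_mx (\rank M) *m row_ebase M).
rewrite -mulmxA [pid_mx _ *m (_ *m _)]mulmxA mul_pid_mx minnn (minn_idPr le_m).
by rewrite mulmxA mulmx_ebase.
Qed.

(** With [H] a pencil, this trades the determinant of a transfer matrix for that of a polynomial
    system matrix. *)
Lemma det_schur (F : comNzRingType) (n m : nat) (H J : 'M[F]_n)
  (b : 'M[F]_(m, n)) (c : 'M[F]_(n, m)) (d : 'M[F]_m) :
  J *m H = 1%:M ->
  \det H * \det (b *m J *m c + d) = \det (block_mx H c (- b) d).
Proof.
move=> JH.
have -> : block_mx H c (- b) d =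
    block_mx 1%:M 0 (- (b *m J)) 1%:M *m block_mx H c 0 (b *m J *m c + d).
  rewrite mulmx_block !mul1mx !mul0mx !addr0 mulNmx -[b *m J *m H]mulmxA JH mulmx1.
  by rewrite mulNmx addKr.
by rewrite det_mulmx det_lblock !det1 !mul1r det_ublock.
Qed.

(** * Top coefficients of products and determinants *)

Lemma size_mul_top (R : nzRingType) (f g : {poly R}) (d e : nat) :
  (size f <= d.+1)%N -> (size g <= e.+1)%N -> (size (f * g)%R <= (d + e).+1)%N.
Proof.
move=> sf sg; apply: leq_trans (size_polyMleq _ _) _.
by have := leq_add sf sg; rewrite addSn addnS; case: (_ + _)%N.
Qed.

Lemma coef_mul_top (R : nzRingType) (f g : {poly R}) (d e : nat) :
  (size f <= d.+1)%N -> (size g <= e.+1)%N -> (f * g)`_(d + e) = f`_d * g`_e.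
Proof.
move=> sf sg; rewrite coefM.
have dl : (d < (d + e).+1)%N by rewrite ltnS leq_addr.
rewrite (bigD1 (Ordinal dl)) //= addKn big1 ?addr0 // => j.
rewrite -val_eqE /= neq_ltn => /orP[lt|gt].
  rewrite [X in _ * X]nth_default ?mulr0 //.
  by apply: leq_trans sg _; rewrite ltn_subRL ltn_add2r.
by rewrite [X in X * _]nth_default ?mul0r //; apply: leq_trans sf _.
Qed.

Lemma coef_prod_top (R : comNzRingType) (I : Type) (s : seq I) (f : I -> {poly R})
    (d : nat) :
  (forall i, (size (f i) <= d.+1)%N) ->
  (size (\prod_(i <- s) f i)%R <= (d * size s).+1)%N /\
  (\prod_(i <- s) f i)`_(d * size s) = \prod_(i <- s) (f i)`_d.
Proof.
move=> sf; elim: s => [|i s [IHs IHc]].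
  by rewrite !big_nil muln0 size_poly1 coef1.
by rewrite !big_cons /= mulnS size_mul_top // coef_mul_top // IHc.
Qed.

Lemma det_coef_top (R : comNzRingType) (k d : nat) (M : 'M[{poly R}]_k) :
  (forall i j, (size (M i j) <= d.+1)%N) ->
  (size (\det M) <= (d * k).+1)%N /\
  (\det M)`_(d * k) = \det (map_mx (fun q : {poly R} => q`_d) M).
Proof.
move=> sM.
have H (s : 'S_k) := @coef_prod_top R _ (index_enum 'I_k) (fun i => M i (s i)) d
  (fun i => sM i (s i)).
have sz : size (index_enum 'I_k) = k by rewrite /index_enum -enumT size_enum_ord.
rewrite sz in H.
split.
  apply: leq_trans (size_sum _ _ _) _; apply/bigmax_leqP => s _.
  by rewrite size_Msign; case: (H s).
rewrite coef_sum; apply: eq_bigr => s _.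
case: (H s) => _ E; case: (odd_perm s); rewrite !(expr0, expr1, mul1r, mulN1r) ?coefN E.
  by congr (- _); apply: eq_bigr => i _; rewrite mxE.
by apply: eq_bigr => i _; rewrite mxE.
Qed.

(** * Polynomial inputs and constancy of the pencil determinant *)

(** The shift preserves degree and leading coefficient, so [e = 1] when [q] is nonzero. Then [q]
    takes the value [q(0)] at every natural number, and these are distinct in [R]. *)
Lemma poly_dvd_shift_const (R : realFieldType) (q e : {poly R}) :
  q \Po ('X + 1%:P) = e * q -> (size q <= 1)%N.
Proof.
have [->|q0 E] := eqVneq q 0; first by rewrite size_poly0.
have s2 : size ('X + 1%:P : {poly R}) = 2 by rewrite size_XaddC.
have sq := size_comp_poly2 q s2.
have e0 : e != 0.
  by apply: contraNneq q0 => e0; rewrite -size_poly_eq0 -sq E e0 mul0r size_poly0.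
have /eqP/size_poly1P[k k0 ek] : size e = 1%N.
  move: sq; rewrite E size_mul //.
  by case: (size e) (size_poly_gt0 e) (size_poly_gt0 q) => [|[|j]];
     rewrite ?e0 ?q0 // => _ gt0; rewrite !addSn /= => /eqP;
     rewrite -[X in _ == X]add0n -addSn eqn_add2r.
have := lead_coef_comp q (q := 'X + 1%:P); rewrite s2 => /(_ isT).
rewrite lead_coefXaddC expr1n mulr1 E ek lead_coefM lead_coefC => /eqP.
rewrite -subr_eq0 -{2}[lead_coef q]mul1r -mulrBl mulf_eq0 lead_coef_eq0 (negPf q0).
rewrite orbF subr_eq0 => /eqP k1; rewrite ek k1 mul1r in E.
have qn j : q.[j%:R] = q.[0].
  elim: j => // j <-; rewrite -{2}E horner_comp !hornerE.
  by rewrite -natr1.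
suff -> : q = q.[0]%:P by apply: size_polyC_leq1.
apply/eqP; rewrite -subr_eq0; apply/eqP.
apply: (@roots_geq_poly_eq0 _ _ [seq j%:R | j <- iota 0 (size (q - q.[0]%:P))]).
- by apply/allP=> _ /mapP[j _ ->]; rewrite /root !hornerE qn subrr.
- by rewrite map_inj_uniq ?iota_uniq //; apply: mulrIn (oner_neq0 _).
- by rewrite size_map size_iota.
Qed.

Lemma hs_iter_sub (R : realFieldType) (n m p : nat)
  (A : 'M[R]_n) (B : 'M[R]_(n, m)) (C : 'M[R]_(p, n)) (D : 'M[R]_(p, m))
  (S : 'M[R]_n) i :
  (hs_step A B C D S <= S)%MS -> (hs_iter A B C D i <= S)%MS.
Proof.
move=> SS; elim: i => [|i IH]; first exact: sub0mx.
by apply: submx_trans SS; apply: hs_step_mono.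
Qed.

(* An impulsive input steering to [Y] is a polynomial in the Laplace variable
   [z]; one more step of the recursion multiplies it by [z]. *)
Lemma hs_iter_poly (R : realFieldType) (n m p k r : nat)
  (A : 'M[R]_n) (B : 'M[R]_(n, m)) (C : 'M[R]_(p, n)) (D : 'M[R]_(p, m))
  (z : {poly R}) (T : 'M[R]_(r, n)) (i : nat) (Y : 'M[R]_(k, n)) :
  (forall j, (hs_iter A B C D j <= T)%MS) -> (Y <= hs_iter A B C D i)%MS ->
  exists (X : 'M[{poly R}]_(k, r)) (U : 'M[{poly R}]_(k, m)),
    X *m map_mx polyC T *m (z%:M - map_mx polyC A^T) - U *m map_mx polyC B^T
      = map_mx polyC Y /\
    X *m map_mx polyC T *m map_mx polyC C^T + U *m map_mx polyC D^T = 0.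
Proof.
move=> ST; elim: i Y => [|i IH] Y.
  rewrite submx0 => /eqP->; exists 0, 0.
  by rewrite !mul0mx subrr addr0 map_mx0.
case/hs_stepP=> w [u [wi K0 ->]].
have [X [U [E1 E2]]] := IH w wi.
have /submxP[v wv] := submx_trans wi (ST i).
have wv' : map_mx polyC w = map_mx polyC v *m map_mx polyC T by rewrite wv map_mxM.
(* As [w = v T], these witnesses turn the value [w] of the first equation into [z w - w (z - A^T) +
   u B^T = w A^T + u B^T]. *)
exists (z *: X - map_mx polyC v), (z *: U - map_mx polyC u).
rewrite [(_ - _) *m map_mx polyC T]mulmxBl -wv' -!scalemxAl; split.
  rewrite mulmxBl -scalemxAl (canRL (subrK _) E1) mulmxBl -scalemxAl.
  rewrite mulmxBr mul_mx_scalar map_mxD !map_mxM scalerDr.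
  by rewrite [X in X - _ - _]addrC addrKA opprK [X in X - _]addrC addrKA opprK.
rewrite !mulmxBl -!scalemxAl addrACA -scalerDr E2 scaler0 add0r -opprD.
by rewrite -!map_mxM -map_mxD K0 map_mx0 oppr0.
Qed.

(* With [J = [1; 0]] the hypotheses say [J^T = [X U] P], so that
   [P(s + 1) = P(s) + J J^T = (1 + J [X U]) P(s)]. *)
Lemma pencil_det_const (R : realFieldType) (r m : nat)
  (A : 'M[R]_r) (B : 'M[R]_(m, r)) (C : 'M[R]_(r, m)) (D : 'M[R]_m)
  (X : 'M[{poly R}]_r) (U : 'M[{poly R}]_(r, m)) :
  X *m ('X%:M - map_mx polyC A) - U *m map_mx polyC B = 1%:M ->
  X *m map_mx polyC C + U *m map_mx polyC D = 0 ->
  exists k : R, forall z : {poly R},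
    \det (block_mx (z%:M - map_mx polyC A) (map_mx polyC C)
                   (- map_mx polyC B) (map_mx polyC D)) = k%:P.
Proof.
move=> E1 E2; pose P z := block_mx (z%:M - map_mx polyC A) (map_mx polyC C)
  (- map_mx polyC B) (map_mx polyC D).
(* One polynomial in ['X] gives the determinant at every [z]: at ['X + 1] for the divisibility, and
   at [- 'X] when the result is used for [G(-s)]. *)
have Pz z : \det (P z) = \det (P 'X) \Po z.
  have cC k l (M : 'M[R]_(k, l)) : map_mx (comp_poly z) (map_mx polyC M) = map_mx polyC M.
    by apply/matrixP=> i j; rewrite !mxE comp_polyC.
  rewrite -(det_map_mx (comp_poly z)) map_block_mx map_mxN !cC map_mxB cC.
  by rewrite map_scalar_mx /= comp_polyX.
have /size1_polyC PX : (size (\det (P 'X)) <= 1)%N.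
  apply: (@poly_dvd_shift_const _ _ (\det (1%:M + col_mx 1%:M 0 *m row_mx X U))).
  rewrite -det_mulmx mulmxDl mul1mx -mulmxA mul_row_block.
  rewrite mulmxN E1 E2 mul_col_row !mul0mx !mul1mx -Pz.
  by rewrite add_block_mx !addr0 /P raddfD /= addrAC.
by exists (\det (P 'X))`_0 => z; rewrite -/(P z) Pz PX comp_polyC coefC.
Qed.

(** * Factorization of the transfer matrix through the reachable subspace *)

(** Invariance reads [T (z - a) = (z - A1) T + T c K], so [T J = H T - H T c K J]. Substituting this
    and [b = B1 T - d K] makes [1 - K J c] a common right factor. *)
Lemma transfer_factor (F : comNzRingType) (n m p r : nat) (z : F)
  (a : 'M[F]_n) (b : 'M[F]_(m, n)) (c : 'M[F]_(n, p)) (d : 'M[F]_(m, p))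
  (T : 'M[F]_(r, n)) (A1 : 'M[F]_r) (B1 : 'M[F]_(m, r)) (K : 'M[F]_(p, n))
  (C1 : 'M[F]_(r, m)) (D1 : 'M[F]_m) (Q : 'M[F]_(m, p))
  (J : 'M[F]_n) (H : 'M[F]_r) :
  T *m a + T *m c *m K = A1 *m T -> b + d *m K = B1 *m T ->
  T *m c = C1 *m Q -> d = D1 *m Q ->
  (z%:M - a) *m J = 1%:M -> H *m (z%:M - A1) = 1%:M ->
  b *m J *m c + d = (B1 *m H *m C1 + D1) *m (Q *m (1%:M - K *m J *m c)).
Proof.
move=> Ta bd Tc dQ aJ HA.
have TJ : T *m J = H *m T - H *m (T *m c *m K) *m J.
  have {1}-> : T = H *m T *m (z%:M - a) - H *m (T *m c *m K).
    rewrite mulmxBr -addrA -opprD -[H *m T *m a]mulmxA -mulmxDr Ta.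
    rewrite -mulmxA mul_mx_scalar -mul_scalar_mx -mulmxBr -mulmxBl mulmxA HA.
    by rewrite mul1mx.
  by rewrite mulmxBl -[_ *m (z%:M - a) *m J]mulmxA aJ mulmx1.
have -> : b = B1 *m T - d *m K by rewrite -bd addrK.
rewrite mulmxA [in RHS]mulmxDl -dQ -[B1 *m H *m C1 *m Q]mulmxA -Tc.
rewrite mulmxBl -[B1 *m T *m J]mulmxA TJ [RHS]mulmxBr mulmx1 !(mulmxBl, mulmxBr) !mulmxDl !mulmxA.
by rewrite opprD addrA [LHS]addrAC; congr (_ - _); rewrite addrAC.
Qed.

(** Stationarity serves in both directions: [stepS] gives the output injection, [Sstep] the rank
    bound. Full row rank of [Q] stays a premise of the last clause, since it is deduced from
    left-invertibility. *)
Lemma reachable_reduction (R : realFieldType) (n m p : nat)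
  (A : 'M[R]_n) (B : 'M[R]_(n, m)) (C : 'M[R]_(p, n)) (D : 'M[R]_(p, m))
  (r := \rank (strongly_reachable A B C D)) :
  exists (T : 'M[R]_(r, n)) (A1 : 'M[R]_r) (B1 : 'M[R]_(m, r)) (K : 'M[R]_(p, n))
         (C1 : 'M[R]_(r, m)) (D1 : 'M[R]_m) (Q : 'M[R]_(m, p)),
    [/\ T *m A^T + T *m C^T *m K = A1 *m T, B^T + D^T *m K = B1 *m T,
        T *m C^T = C1 *m Q, D^T = D1 *m Q &
        row_free Q -> exists k : R, forall z : {poly R},
          \det (block_mx (z%:M - map_mx polyC A1) (map_mx polyC C1)
                   (- map_mx polyC B1) (map_mx polyC D1)) = k%:P].
Proof.
set S := strongly_reachable A B C D in r *.
have [T TS Tfree] : exists2 T : 'M[R]_(r, n), (T :=: S)%MS & row_free T.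
  by exists (row_base S); [apply: eq_row_base | apply: row_base_free].
have stepS : (hs_step A B C D S <= S)%MS by exact: hs_iter_stationary.
have Sstep : (S <= hs_step A B C D S)%MS by exact: hs_iter_leS.
pose M := col_mx (T *m C^T) D^T; pose N := col_mx (T *m A^T) B^T.
have kerS : (kermx M *m N <= S)%MS.
  move: (kermx M) (mulmx_ker M) => k kM.
  apply: submx_trans stepS; apply/hs_stepP.
  exists (lsubmx k *m T), (rsubmx k); split.
  - by rewrite -TS submxMl.
  - by rewrite -mulmxA -mul_row_col hsubmxK.
  - by rewrite -mulmxA -mul_row_col hsubmxK.
have Sker : (S <= kermx M *m N)%MS.
  have [w [u [wS K0 E]]] := (hs_stepP _ _ _ _ _ _ _ _ _ _ _).1 Sstep.
  move: wS; rewrite -TS => /submxP[v wv].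
  rewrite [X in (X <= _)%MS]E wv -mulmxA -mul_row_col; apply: submxMr; apply/sub_kermxP.
  by rewrite mul_row_col mulmxA -wv.
(* The left kernel of [M] has dimension [r + m - \rank M], and its image under [N] contains [S], of
   dimension [r]. *)
have rM : (\rank M <= m)%N.
  have : (r <= r + m - \rank M)%N.
    rewrite -mxrank_ker; apply: leq_trans (mxrankS Sker) _; exact: mxrankM_maxl.
  rewrite leq_subRL; last exact: rank_leq_row.
  by rewrite addnC leq_add2l.
have [M1 [Q MQ]] := @rank_factor _ _ _ _ M rM.
have [K [Z NK]] : exists (K : 'M[R]_(p, n)) (Z : 'M[R]_(r + m, r)), N + M *m K = Z *m T.
  by apply: output_injection; rewrite TS.
have [TC DQ] : T *m C^T = usubmx M1 *m Q /\ D^T = dsubmx M1 *m Q.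
  by apply: eq_col_mx; rewrite -mul_col_mx vsubmxK.
have [TA BK] : T *m A^T + T *m C^T *m K = usubmx Z *m T /\
               B^T + D^T *m K = dsubmx Z *m T.
  by apply: eq_col_mx; rewrite -mul_col_mx vsubmxK -NK mul_col_mx add_col_mx.
exists T, (usubmx Z), (dsubmx Z), K, (usubmx M1), (dsubmx M1), Q; split=> // Qfree.
have [X [U [E1 E2]]] : exists (X : 'M[{poly R}]_r) (U : 'M[{poly R}]_(r, m)),
    X *m map_mx polyC T *m ('X%:M - map_mx polyC A^T) - U *m map_mx polyC B^T
      = map_mx polyC T /\
    X *m map_mx polyC T *m map_mx polyC C^T + U *m map_mx polyC D^T = 0.
  apply: (@hs_iter_poly _ _ _ _ _ _ _ _ _ _ _ _ n); last by rewrite TS.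
  by move=> j; rewrite TS; apply: hs_iter_sub.
have /row_freeP[Qi QQi] := Qfree.
have /row_freeP[Ti TTi] := Tfree.
have cancel k l (V : 'M[R]_(k, l)) (Vi : 'M[R]_(l, k)) i (Y : 'M[{poly R}]_(i, k)) :
    V *m Vi = 1%:M -> Y *m map_mx polyC V *m map_mx polyC Vi = Y.
  by move=> VVi; rewrite -mulmxA -map_mxM VVi map_mx1 mulmx1.
move: TA BK TC DQ => /(congr1 (map_mx polyC)) + /(congr1 (map_mx polyC)) +
  /(congr1 (map_mx polyC)) + /(congr1 (map_mx polyC)).
rewrite !(map_mxD, map_mxM) /= => TA BK TC DQ.
(* The zero-output equation [E2] is this one multiplied on the right by [Q], which has a right
   inverse. *)
have E20 : X *m map_mx polyC (usubmx M1) + U *m map_mx polyC (dsubmx M1) = 0.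
  rewrite -[LHS](cancel _ _ _ _ _ _ QQi) mulmxDl -2!mulmxA -DQ -TC.
  by rewrite [X *m (_ *m _)]mulmxA E2 mul0mx.
apply: (@pencil_det_const _ _ _ _ _ _ _ X U) => //.
(* After right multiplication by [T], the left side differs from that of [E1] by
   [- (X T C^T + U D^T) K], which vanishes by [E2]. *)
rewrite -[LHS](cancel _ _ _ _ _ _ TTi) -[RHS](cancel _ _ _ _ _ _ TTi) mul1mx.
congr (_ *m _); rewrite mulmxBl -2!mulmxA -BK [(_ - _) *m map_mx _ T]mulmxBl -TA -[RHS]E1.
rewrite mul_scalar_mx opprD !mulmxBr !mulmxDr !mulmxN !mulmxA mul_mx_scalar -scalemxAr.
rewrite addrA opprD addrACA -[RHS]addr0; congr (_ + _).
by rewrite -opprD -mulmxDl E2 mul0mx oppr0.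
Qed.

(** * Behaviour of polynomial matrices at infinity *)

(** Here [d] is a formal degree: [L] may be singular or zero, so the relation passes to products and
    determinants without side conditions. *)
Definition topcoef_mx {R : nzRingType} {k l : nat} (d : nat)
    (M : 'M[{poly R}]_(k, l)) (L : 'M[R]_(k, l)) :=
  forall i j, (size (M i j) <= d.+1)%N /\ (M i j)`_d = L i j.

Lemma topcoef_mulmx (R : comNzRingType) (k l q d e : nat)
  (M : 'M[{poly R}]_(k, l)) (N : 'M[{poly R}]_(l, q)) (L : 'M[R]_(k, l)) (L' : 'M[R]_(l, q)) :
  topcoef_mx d M L -> topcoef_mx e N L' -> topcoef_mx (d + e) (M *m N) (L *m L').
Proof.
move=> HM HN i j; rewrite !mxE; split.
  apply: leq_trans (size_sum _ _ _) _; apply/bigmax_leqP => s _.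
  by apply: size_mul_top; [case: (HM i s) | case: (HN s j)].
rewrite coef_sum; apply: eq_bigr => s _.
case: (HM i s) (HN s j) => s1 <- [s2 <-]; exact: coef_mul_top.
Qed.

Lemma topcoef_polyC (R : nzRingType) (k l : nat) (M : 'M[R]_(k, l)) :
  topcoef_mx 0 (map_mx polyC M) M.
Proof. by move=> i j; rewrite mxE coefC size_polyC_leq1. Qed.

Lemma topcoef_tr (R : nzRingType) (k l d : nat)
  (M : 'M[{poly R}]_(k, l)) (L : 'M[R]_(k, l)) :
  topcoef_mx d M L -> topcoef_mx d M^T L^T.
Proof. by move=> H i j; rewrite !mxE. Qed.

Lemma topcoef_det (R : comNzRingType) (k d : nat)
  (M : 'M[{poly R}]_k) (L : 'M[R]_k) :
  topcoef_mx d M L ->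
  (size (\det M) <= (d * k).+1)%N /\ (\det M)`_(d * k) = \det L.
Proof.
move=> H; have [|-> ->] := @det_coef_top _ _ d M; first by move=> i j; case: (H i j).
by split=> //; congr (\det _); apply/matrixP=> i j; rewrite mxE; case: (H i j).
Qed.

(** The scalar [e] is later [1] or [-1], which treats [s] and [-s] together. *)
Lemma topcoef_pencil (R : comNzRingType) (n : nat) (e : R) (a : 'M[R]_n) :
  topcoef_mx 1 ((e *: 'X)%:M - map_mx polyC a) e%:M.
Proof.
move=> i j; rewrite !mxE; split.
  apply: leq_trans (size_polyD _ _) _; rewrite geq_max size_polyN.
  rewrite (leq_trans (size_polyC_leq1 _)) // andbT.
  case: (_ == _); rewrite ?mulr1n ?mulr0n ?size_poly0 //.
  by apply: leq_trans (size_scale_leq _ _) _; rewrite size_polyX.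
rewrite coefB coefC subr0 coefMn coefZ coefX mulr1.
by [].
Qed.

Lemma size_adj_pencil (R : comNzRingType) (n : nat) (e : R) (a : 'M[R]_n) i j :
  (size (\adj ((e *: 'X)%:M - map_mx polyC a) i j) <= n)%N.
Proof.
rewrite mxE /cofactor size_Msign; set M := row' _ _.
have /topcoef_det[sM _] : topcoef_mx 1 M (row' j (col' i (e%:M : 'M[R]_n))).
  by move=> i' j'; have := topcoef_pencil _ _ e a (lift j i') (lift i j'); rewrite !mxE.
apply: leq_trans sM _; rewrite mul1n.
(* For [n = 0] the bound [n.-1.+1 <= n] is false, but there is no index [i]. *)
by case: n a i j M => [|n] a [] //.
Qed.

Lemma size_mul_polyC_mx (R : nzRingType) (k l q s : nat)
  (K : 'M[R]_(k, l)) (M : 'M[{poly R}]_(l, q)) i j :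
  (forall i j, (size (M i j) <= s)%N) ->
  (size ((map_mx polyC K *m M) i j) <= s)%N.
Proof.
move=> sM; rewrite mxE; apply: leq_trans (size_sum _ _ _) _.
apply/bigmax_leqP => h _; rewrite mxE mul_polyC.
exact: leq_trans (size_scale_leq _ _) _.
Qed.

(* Numerator of [1 - K (s - a)^-1 c], which tends to the identity at infinity. *)
Lemma topcoef_resolvent (R : comNzRingType) (n p : nat) (e : R)
  (a : 'M[R]_n) (K : 'M[R]_(p, n)) (c : 'M[R]_(n, p))
  (h := (e *: 'X)%:M - map_mx polyC a) :
  topcoef_mx n ((\det h)%:M - map_mx polyC K *m \adj h *m map_mx polyC c)
    (e ^+ n)%:M.
Proof.
have [sd cd] := topcoef_det _ _ _ _ _ (topcoef_pencil _ n e a).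
rewrite -/h mul1n det_scalar in sd cd.
move=> i j.
have sK : (size ((map_mx polyC K *m \adj h *m map_mx polyC c) i j) <= n)%N.
  rewrite -[_ *m map_mx _ c]trmxK mxE trmx_mul map_trmx.
  apply: size_mul_polyC_mx => i' j'; rewrite mxE.
  by apply: size_mul_polyC_mx => i2 j2; apply: size_adj_pencil.
rewrite mxE [(- _ : 'M__) _ _]mxE [(_%:M) i j]mxE [in RHS]mxE; split.
  apply: leq_trans (size_polyD _ _) _; rewrite geq_max size_polyN.
  rewrite (leq_trans sK) // andbT.
  by case: (_ == _); rewrite ?mulr1n ?mulr0n ?size_poly0.
by rewrite coefB [X in _ - X]nth_default // subr0 coefMn cd.
Qed.

(** If [v Q Q^T = 0], the squares of the entries of [v Q] sum to zero, and the ordering of [R]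
    forces [v Q = 0]. *)
Lemma gram_unit (R : realFieldType) (m p : nat) (Q : 'M[R]_(m, p)) :
  row_free Q -> \det (Q *m Q^T) != 0.
Proof.
move=> Qf; rewrite -unitfE -[_ \is a _]/(_ \in unitmx) -row_free_unit.
apply: inj_row_free => v; rewrite mulmxA => E.
apply: (row_free_inj Qf); rewrite mul0mx; move: E => /(congr1 (mulmx^~ v^T)).
rewrite mul0mx -!mulmxA -trmx_mul mulmxA; move: (v *m Q) => w.
move=> /matrixP/(_ 0 0)/eqP; rewrite mxE [X in _ == X]mxE.
rewrite psumr_eq0; last by move=> i _; rewrite mxE -expr2 sqr_ge0.
move=> /allP H; apply/rowP=> i; have := H i (mem_index_enum _).
by rewrite !mxE /= -expr2 sqrf_eq0 => /eqP.
Qed.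

(** * Passage to rational functions *)

Lemma cmxE (R : realFieldType) (k l : nat) (M : 'M[R]_(k, l)) :
  cmx M = map_mx (@FracField.tofrac _) (map_mx polyC M).
Proof. by apply/matrixP=> i j; rewrite !mxE. Qed.

Lemma cmx_tr (R : realFieldType) (k l : nat) (M : 'M[R]_(k, l)) :
  (cmx M)^T = cmx M^T.
Proof. by rewrite !cmxE !map_trmx. Qed.

Lemma map_pencil (R : realFieldType) (n : nat) (z : {poly R}) (a : 'M[R]_n) :
  map_mx (@FracField.tofrac _) (z%:M - map_mx polyC a) = pfrac z *: 1%:M - cmx a.
Proof. by rewrite map_mxB map_scalar_mx -cmxE scalemx1. Qed.

Lemma size_det_pencil (R : realFieldType) (n : nat) (e : R) (a : 'M[R]_n) :
  e != 0 -> size (\det ((e *: 'X)%:M - map_mx polyC a)) = n.+1.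
Proof.
move=> e0; have [sd cd] := topcoef_det _ _ _ _ _ (topcoef_pencil _ n e a).
rewrite mul1n det_scalar in sd cd.
apply/eqP; rewrite eqn_leq sd /= ltnNge; apply/negP => /leq_sizeP/(_ n (leqnn n)) /eqP.
by rewrite cd expf_eq0 (negPf e0) andbF.
Qed.

Lemma det_pencil_neq0 (R : realFieldType) (n : nat) (e : R) (a : 'M[R]_n) :
  e != 0 -> \det (pfrac (e *: 'X) *: 1%:M - cmx a) != 0.
Proof.
move=> e0; rewrite -map_pencil det_map_mx tofrac_eq0 -size_poly_eq0.
by rewrite size_det_pencil.
Qed.

Lemma pencil_unitmx (R : realFieldType) (n : nat) (e : R) (a : 'M[R]_n) :
  e != 0 -> pfrac (e *: 'X) *: 1%:M - cmx a \in unitmx.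
Proof. by move=> e0; rewrite unitmxE unitfE det_pencil_neq0. Qed.

Lemma transfer_tr (R : realFieldType) (n m p : nat)
  (A : 'M[R]_n) (B : 'M[R]_(n, m)) (C : 'M[R]_(p, n)) (D : 'M[R]_(p, m)) z :
  (transfer A B C D z)^T =
  cmx B^T *m invmx (z *: 1%:M - cmx A^T) *m cmx C^T + cmx D^T.
Proof.
rewrite /transfer linearD /= !trmx_mul !cmx_tr trmx_inv linearB /= linearZ /= trmx1.
by rewrite cmx_tr mulmxA.
Qed.

(** The last two clauses clear denominators: a characteristic polynomial turns [\det g] into a
    pencil determinant and [V] into a polynomial matrix of known behaviour at infinity. *)
Lemma transfer_reduced (R : realFieldType) (n m p r : nat)
  (A : 'M[R]_n) (B : 'M[R]_(n, m)) (C : 'M[R]_(p, n)) (D : 'M[R]_(p, m))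
  (T : 'M[R]_(r, n)) (A1 : 'M[R]_r) (B1 : 'M[R]_(m, r)) (K : 'M[R]_(p, n))
  (C1 : 'M[R]_(r, m)) (D1 : 'M[R]_m) (Q : 'M[R]_(m, p)) (e : R)
  (z := e *: 'X) (h := z%:M - map_mx polyC A^T) :
  e != 0 ->
  T *m A^T + T *m C^T *m K = A1 *m T -> B^T + D^T *m K = B1 *m T ->
  T *m C^T = C1 *m Q -> D^T = D1 *m Q ->
  exists (g : 'M[ratf R]_m) (V : 'M[ratf R]_p),
    [/\ (transfer A B C D (pfrac z))^T = g *m (cmx Q *m V),
        pfrac (\det (z%:M - map_mx polyC A1)) * \det g =
        pfrac (\det (block_mx (z%:M - map_mx polyC A1) (map_mx polyC C1)
                   (- map_mx polyC B1) (map_mx polyC D1))) &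
        pfrac (\det h) *: V = map_mx (@FracField.tofrac _)
          ((\det h)%:M - map_mx polyC K *m \adj h *m map_mx polyC C^T)].
Proof.
move=> e0 TA BK TC DQ.
have cM k l q (M : 'M[R]_(k, l)) (N : 'M[R]_(l, q)) : cmx (M *m N) = cmx M *m cmx N.
  by rewrite !cmxE !map_mxM.
have cD k l (M N : 'M[R]_(k, l)) : cmx (M + N) = cmx M + cmx N.
  by rewrite !cmxE !map_mxD.
move: TA BK TC DQ => /(congr1 (@cmx R _ _)) + /(congr1 (@cmx R _ _)) +
  /(congr1 (@cmx R _ _)) + /(congr1 (@cmx R _ _)).
rewrite !(cD, cM) => TA BK TC DQ.
set J := invmx (pfrac z *: 1%:M - cmx A^T).
set H := invmx (pfrac z *: 1%:M - cmx A1).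
exists (cmx B1 *m H *m cmx C1 + cmx D1), (1%:M - cmx K *m J *m cmx C^T); split.
- rewrite transfer_tr; apply: (transfer_factor _ _ _ _ _ (pfrac z)) TA BK TC DQ _ _.
    rewrite -[(pfrac z)%:M]scalemx1; exact: mulmxV (pencil_unitmx _ _ _ _ e0).
  rewrite -[(pfrac z)%:M]scalemx1; exact: mulVmx (pencil_unitmx _ _ _ _ e0).
- rewrite /pfrac -!det_map_mx map_pencil det_schur; last first.
    exact: mulVmx (pencil_unitmx _ _ _ _ e0).
  by rewrite map_block_mx map_pencil map_mxN -!cmxE.
- have hJ : map_mx (@FracField.tofrac _) (\adj h) = pfrac (\det h) *: J.
    rewrite map_mx_adj map_pencil /J /invmx pencil_unitmx // scalerA.
    by rewrite /pfrac -det_map_mx map_pencil divff ?scale1r // det_pencil_neq0.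
  rewrite map_mxB map_scalar_mx !map_mxM -!cmxE /= hJ scalerBr scalemx1.
  by rewrite -scalemxAr -scalemxAl.
Qed.

(** * The spectral product is a polynomial *)

(** With [H] and [H'] the pencils at [s] and [-s], the last matrix is the system matrix of [G(s)]
    followed by [G(-s)^T], realized with [2 n] states. Its polynomial entries show that the two
    characteristic polynomials clear every denominator. *)
Lemma det_cascade (F : comNzRingType) (n m p : nat) (H H' J J' : 'M[F]_n)
  (B : 'M[F]_(n, m)) (C : 'M[F]_(p, n)) (D : 'M[F]_(p, m)) :
  J *m H = 1%:M -> J' *m H' = 1%:M ->
  \det H * \det H' * \det ((B^T *m J' *m C^T + D^T) *m (C *m J *m B + D)) =
  \det (block_mx (block_mx H' (- (C^T *m C)) 0 H)
    (col_mx (C^T *m D) B) (- row_mx B^T (D^T *m C)) (D^T *m D)).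
Proof.
move=> JH JH'.
rewrite -(@det_schur _ _ _ _ (block_mx J' (J' *m (C^T *m C) *m J) 0 J)); last first.
  rewrite mulmx_block !mul0mx !mulmx0 !addr0 add0r JH JH' mulmxN -[_ *m J *m H]mulmxA JH.
  by rewrite mulmx1 addNr scalar_mx_block.
rewrite det_ublock [\det H * _]mulrC; congr (_ * \det _).
rewrite mul_row_block mulmx0 addr0 mul_row_col !(mulmxDl, mulmxDr) !mulmxA.
by rewrite !addrA; congr (_ + _ + _); apply: addrC.
Qed.

Lemma spectral_product_poly (R : realFieldType) (n m p : nat)
  (A : 'M[R]_n) (B : 'M[R]_(n, m)) (C : 'M[R]_(p, n)) (D : 'M[R]_(p, m)) :
  exists q : {poly R}, pfrac q = spectral_product A B C D.
Proof.
pose P k l (M : 'M[R]_(k, l)) := map_mx polyC M.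
exists (\det (block_mx (block_mx ((-'X)%:M - P _ _ A^T) (- ((P _ _ C)^T *m P _ _ C))
                                0 ('X%:M - P _ _ A))
    (col_mx ((P _ _ C)^T *m P _ _ D) (P _ _ B))
    (- row_mx (P _ _ B)^T ((P _ _ D)^T *m P _ _ C)) ((P _ _ D)^T *m P _ _ D))).
rewrite /pfrac -det_map_mx map_block_mx map_block_mx map_col_mx !map_mxN map_row_mx.
rewrite map_mx0 !map_pencil !map_mxM -!map_trmx /P -!cmxE.
have zN : pfrac (- 'X) = - svar R by rewrite /pfrac rmorphN.
have uX := @pencil_unitmx R n 1 A (oner_neq0 _).
have uN := @pencil_unitmx R n (-1) A^T; rewrite oppr_eq0 oner_neq0 in uN.
rewrite scale1r in uX; rewrite scaleN1r zN in uN; rewrite zN.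
rewrite /spectral_product /tfGneg transfer_tr /tfG /transfer -[pfrac 'X]/(svar R).
have -> : \det (- svar R *: 1%:M - cmx A) = \det (- svar R *: 1%:M - cmx A^T).
  by rewrite -cmx_tr -[RHS]det_tr linearB /= linearZ /= trmx1 trmxK.
rewrite -(cmx_tr _ _ _ B) -(cmx_tr _ _ _ C) -(cmx_tr _ _ _ D).
symmetry; apply: det_cascade.
  exact: mulVmx uX.
exact: mulVmx (uN isT).
Qed.

(** * Degree count for the spectral product *)

(** In use, [a], [a'], [a1], [a1'] are characteristic polynomials at [s] and [-s]; multiplying by
    them leaves an identity between polynomials. The exponent [m] comes from scaling a determinant
    of order [m]. *)
Lemma gram_det_factor (F : comNzRingType) (m p : nat) (a a' a1 a1' k : F)
  (g g' : 'M[F]_m) (V V' : 'M[F]_(m, p)) :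
  a1 * \det g = k -> a1' * \det g' = k ->
  (a * a' * \det (g' *m V' *m (g *m V)^T)) * ((a' * a) ^+ m * (a1' * a1)) =
  a * a' * (k * k) * \det ((a' *: V') *m (a *: V)^T).
Proof.
move=> E E'; rewrite -{1}E' -E trmx_mul mulmxA -[g' *m V' *m V^T]mulmxA !det_mulmx det_tr.
rewrite linearZ /= -scalemxAl -scalemxAr scalerA detZ.
ring.
Qed.

Theorem mainTheorem8 (R : realFieldType) (n m p : nat)
  (A : 'M[R]_n) (B : 'M[R]_(n, m)) (C : 'M[R]_(p, n)) (D : 'M[R]_(p, m)) :
  left_invertible (tfG A B C D) ->
  exists (q : {poly R}) (ns : nat),
    pfrac q = spectral_product A B C D /\
    (size q).-1 = (ns * 2)%N /\
    \rank (strongly_reachable A B C D) = (n - ns)%N.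
Proof.
case=> L LG.
have [q Eq] := spectral_product_poly R n m p A B C D.
set r := \rank _.
have rn : (r <= n)%N by apply: rank_leq_row.
exists q, (n - r)%N; split=> //; split; last by rewrite subKn.
have [T [A1 [B1 [K [C1 [D1 [Q [TA BK TC DQ kP]]]]]]]] := reachable_reduction R n m p A B C D.
rewrite -/r in T A1 B1 C1 TA BK TC kP *.
have N0 : (-1 : R) != 0 by rewrite oppr_eq0 oner_neq0.
have [g [V [Eg gk Vh]]] := transfer_reduced R n m p r A B C D T A1 B1 K C1 D1 Q 1
  (oner_neq0 _) TA BK TC DQ.
have [g' [V' [Eg' gk' Vh']]] := transfer_reduced R n m p r A B C D T A1 B1 K C1 D1 Q (-1)
  N0 TA BK TC DQ.
rewrite scale1r -[pfrac 'X]/(svar R) -[transfer _ _ _ _ _]/(tfG A B C D) in Eg.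
have zN : pfrac (- 'X) = - svar R by rewrite /pfrac rmorphN.
rewrite scaleN1r zN -[transfer _ _ _ _ _]/(tfGneg A B C D) in Eg'.
(* Transposing [L G = 1] gives [g] a right inverse. As [g] is square this inverse is two-sided, so
   [Q] is right-invertible over the rational functions and hence row free over [R]. *)
have gL : g *m (cmx Q *m V *m L^T) = 1%:M.
  by rewrite mulmxA -Eg -trmx_mul LG trmx1.
have QL : cmx Q *m (V *m L^T *m g) = 1%:M.
  by rewrite !mulmxA; apply: mulmx1C.
have g0 : \det g != 0.
  by apply/eqP => g0; have /eqP := congr1 determinant gL;
     rewrite det_mulmx g0 mul0r det1 eq_sym oner_eq0.
have Qfree : row_free Q.
  apply: inj_row_free => v vQ; apply/rowP => i; apply/eqP.
  have : cmx v = 0.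
    rewrite -[cmx v]mulmx1 -QL mulmxA.
    have -> : cmx v *m cmx Q = 0 by rewrite !cmxE -!map_mxM vQ !map_mx0.
    by rewrite mul0mx.
  by move=> /rowP/(_ i)/eqP; rewrite !mxE tofrac_eq0 polyC_eq0.
have [k Pk] := kP Qfree.
rewrite Pk in gk; rewrite Pk in gk'.
have k0 : k != 0.
  apply: contraNneq g0 => k0; move/eqP: gk.
  rewrite k0 polyC0 [X in _ == X]rmorph0 mulf_eq0 => /orP[|gE]; last exact: gE.
  by rewrite tofrac_eq0 -size_poly_eq0 size_det_pencil ?oner_neq0.
set h := (1 *: 'X)%:M - map_mx polyC A^T in Vh.
set h' := (-1 *: 'X)%:M - map_mx polyC A^T in Vh'.
set h1 := (1 *: 'X)%:M - map_mx polyC A1 in gk.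
set h1' := (-1 *: 'X)%:M - map_mx polyC A1 in gk'.
set N := (X in map_mx _ X) in Vh.
set N' := (X in map_mx _ X) in Vh'.
pose W := map_mx polyC Q *m N; pose W' := map_mx polyC Q *m N'.
have EW : map_mx (@FracField.tofrac _) W = pfrac (\det h) *: (cmx Q *m V).
  by rewrite map_mxM -cmxE -Vh scalemxAr.
have EW' : map_mx (@FracField.tofrac _) W' = pfrac (\det h') *: (cmx Q *m V').
  by rewrite map_mxM -cmxE -Vh' scalemxAr.
have hE : pfrac (\det h) = \det (svar R *: 1%:M - cmx A).
  rewrite /pfrac -det_map_mx map_pencil scale1r -det_tr -cmx_tr linearB /= linearZ /=.
  by rewrite trmx1 trmxK.
have hE' : pfrac (\det h') = \det (- svar R *: 1%:M - cmx A).
  rewrite /pfrac -det_map_mx map_pencil scaleN1r zN -det_tr -cmx_tr linearB /= linearZ /=.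
  by rewrite trmx1 trmxK.
have key : q * ((\det h' * \det h) ^+ m * (\det h1' * \det h1)) =
    \det h * \det h' * (k%:P * k%:P) * \det (W' *m W^T).
  have dW : pfrac (\det (W' *m W^T)) =
      \det ((pfrac (\det h') *: (cmx Q *m V')) *m (pfrac (\det h) *: (cmx Q *m V))^T).
    by rewrite -EW -EW' /pfrac -det_map_mx map_mxM -map_trmx.
  apply/eqP; rewrite -tofrac_eq !tofracM tofracXn tofracM.
  apply/eqP; rewrite -[FracField.tofrac q]/(pfrac q) Eq /spectral_product -hE -hE'.
  rewrite -[FracField.tofrac (\det (W' *m W^T))]/(pfrac _) dW.
  rewrite Eg' -[tfG A B C D]trmxK Eg.
  exact: gram_det_factor.
have [sN cN] : (size (\det (W' *m W^T)) <= ((n + n) * m).+1)%N /\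
   (\det (W' *m W^T))`_((n + n) * m) =
   \det ((Q *m ((-1) ^+ n)%:M) *m (Q *m (1 ^+ n)%:M)^T).
  apply: topcoef_det; apply: topcoef_mulmx; last apply: topcoef_tr.
    exact: topcoef_mulmx (topcoef_polyC _ _ _ _) (topcoef_resolvent _ _ _ _ _ _ _).
  exact: topcoef_mulmx (topcoef_polyC _ _ _ _) (topcoef_resolvent _ _ _ _ _ _ _).
(* The top coefficient is [\det (Q Q^T)] up to sign, so the degree bound is attained. *)
have sW : size (\det (W' *m W^T)) = ((n + n) * m).+1.
  apply/eqP; rewrite eqn_leq sN /= ltnNge; apply/negP => /leq_sizeP/(_ _ (leqnn _)) /eqP.
  rewrite cN expr1n mulmx1 mul_mx_scalar -scalemxAl detZ mulf_eq0.
  by rewrite (negPf (gram_unit _ _ _ _ Qfree)) orbF !expf_eq0 oppr_eq0 oner_eq0 !andbF.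
have sh := size_det_pencil R n 1 A^T (oner_neq0 _).
have sh' := size_det_pencil R n (-1) A^T N0.
have sh1 := size_det_pencil R r 1 A1 (oner_neq0 _).
have sh1' := size_det_pencil R r (-1) A1 N0.
rewrite -/h -/h' -/h1 -/h1' in sh sh' sh1 sh1'.
have nz (f : {poly R}) d : size f = d.+1 -> f != 0.
  by move=> sf; rewrite -size_poly_eq0 sf.
have degM (f f' : {poly R}) : f != 0 -> f' != 0 ->
    (size (f * f')%R).-1 = ((size f).-1 + (size f').-1)%N.
  move=> f0 f0'; rewrite size_mul //; move: f0 f0'; rewrite -!size_poly_gt0.
  by case: (size f) (size f') => [|d] [|d'] // _ _; rewrite addSn addnS.
have [[H H'] [H1 H1']] := ((nz _ _ sh, nz _ _ sh'), (nz _ _ sh1, nz _ _ sh1')).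
have HW := nz _ _ sW; have Hk : k%:P != 0 by rewrite polyC_eq0.
have Hm := expf_neq0 m (mulf_neq0 H' H).
have Hhh := mulf_neq0 H H'; have Hkk := mulf_neq0 Hk Hk.
have Hh1 := mulf_neq0 H1' H1; have Hr := mulf_neq0 Hhh Hkk.
have q0 : q != 0.
  apply: contra_eq_neq key => ->; rewrite mul0r eq_sym; exact: mulf_neq0 Hr HW.
(* Degrees in [key] give [deg q + 2 n m + 2 r = 2 n + 2 n m], the constant [k] contributing
   nothing. *)
have := congr1 (fun f : {poly R} => (size f).-1) key.
rewrite (degM _ _ q0 (mulf_neq0 Hm Hh1)) (degM _ _ Hm Hh1) (degM _ _ H1' H1).
rewrite (degM _ _ Hr HW) (degM _ _ Hhh Hkk) (degM _ _ H H') (degM _ _ Hk Hk).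
rewrite size_exp (degM _ _ H' H) sh sh' sh1 sh1' sW size_polyC k0 /=.
move: rn; clear; lia.
Qed.
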